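(* Let $A$ be a weak GCD domain, $M$ a PS module over $A$ and $N$ a submodule of $M$. Let $P$ be the intersection of all PS submodules of $M$ containing $N$. For a submodule $Q$ of $M$, let $Q'$ be the submodule of $M$ generated by all vectors $x/a$ where $x\in Q$ and $bx\in aQ$ for some coprime scalars $a,b\in A-\{0\}$. Define $N_0=N$ and $N_{n+1}=N_n'$ for $n\ge 0$, giving an ascending sequence $N_0\subseteq N_1\subseteq N_2\subseteq\cdots$ of submodules of $M$. Then $P$ is a PS module and $P=\bigcup_{n\ge 0}N_n$.
   Context: All rings are commutative and unitary. For an integral domain $A$, a torsion-free $A$-module $M$ is a PS module (pre-Schreier module) if every equality $ax=by$ with $a,b\in A-\{0\}$ and $x,y\in M-\{0\}$ has a refinement, i.e. there exist $c,d,e\in A$ and $z\in M$ with $a=ce$, $b=cd$, $x=dz$, $y=ez$. A PS submodule is a submodule which is a PS module. Two elements $a,b\in A-\{0\}$ are coprime if their gcd is $1$, i.e. their only common divisors are units. $A$ is a weak GCD domain if each pair $a,b\in A-\{0\}$ has a maximal common divisor, that is, a common divisor $d$ such that $a/d$ and $b/d$ are coprime. For $x\in M$ and $a\in A-\{0\}$, $x/a$ denotes the unique element $m$ with $am=x$ (in $K\otimes_A M$, $K$ the quotient field of $A$); when $M$ is PS, $a,b$ are coprime and $bx\in aM$, this element lies in $M$. *)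

(* Defs.v *)
From HB Require Import structures.
From mathcomp Require Import all_boot all_order all_algebra.
From mathcomp Require Import boolp classical_sets.

Set Implicit Arguments.
Unset Strict Implicit.
Unset Printing Implicit Defensive.

Import GRing.Theory.
Local Open Scope classical_set_scope.
Local Open Scope ring_scope.

Definition divides (A : idomainType) (d a : A) : Prop := exists c : A, a = d * c.

Definition coprime_elts (A : idomainType) (a b : A) : Prop :=
  forall d : A, divides d a -> divides d b -> d \is a GRing.unit.

(* a' and b' are the quotients a/d and b/d, so d is a maximal common divisor. *)
Definition weak_GCD_domain (A : idomainType) : Prop :=
  forall a b : A, a != 0 -> b != 0 ->
    exists d a' b' : A, [/\ a = d * a', b = d * b' & coprime_elts a' b'].

Definition submodule (A : idomainType) (M : lmodType A) (Q : set M) : Prop :=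
  submod_closed [in Q].

Definition torsion_free (A : idomainType) (M : lmodType A) (Q : set M) : Prop :=
  forall (a : A) (x : M), Q x -> a *: x = 0 -> a = 0 \/ x = 0.

Definition has_refinement (A : idomainType) (M : lmodType A) (Q : set M)
    (a b : A) (x y : M) : Prop :=
  exists (c d e : A) (z : M),
    Q z /\ [/\ a = c * e, b = c * d, x = d *: z & y = e *: z].

(* The module is the submodule Q of the ambient M: in particular the vector z of
   a refinement is required to lie in Q. The module M itself is Q = setT. *)
Definition PS_submodule (A : idomainType) (M : lmodType A) (Q : set M) : Prop :=
  [/\ submodule Q, torsion_free Q &
      forall (a b : A) (x y : M), a != 0 -> b != 0 ->
        Q x -> Q y -> x != 0 -> y != 0 ->
        a *: x = b *: y -> has_refinement Q a b x y].

Definition PS_module (A : idomainType) (M : lmodType A) : Prop :=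
  PS_submodule [set: M].

Definition generated_submodule (A : idomainType) (M : lmodType A) (S : set M) :
    set M :=
  \bigcap_(Q in [set Q : set M | submodule Q /\ S `<=` Q]) Q.

(* m = x / a is expressed by a *: m = x; by fraction_exists and fraction_unique
   below, each such fraction is exactly one vector of M when M is PS. *)
Definition coprime_fractions (A : idomainType) (M : lmodType A) (Q : set M) :
    set M :=
  [set m | exists (a b : A) (x : M),
     [/\ a != 0, b != 0 & coprime_elts a b] /\
     [/\ Q x, [set a *: y | y in Q] (b *: x) & a *: m = x]].

Definition derived_submodule (A : idomainType) (M : lmodType A) (Q : set M) :
    set M :=
  generated_submodule (coprime_fractions Q).

Definition derived_seq (A : idomainType) (M : lmodType A) (N : set M) (n : nat) :
    set M :=
  iter n (@derived_submodule A M) N.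

Lemma fraction_exists (A : idomainType) (M : lmodType A) (a b : A) (x y : M) :
  PS_module M -> a != 0 -> b != 0 -> coprime_elts a b -> b *: x = a *: y ->
  exists m : M, a *: m = x.
Proof.
move=> [_ tf ref] a0 b0 cab bxay.
have [->|x0] := eqVneq x 0; first by exists 0; rewrite scaler0.
have y0 : y != 0.
  apply/eqP => y0; move: bxay; rewrite y0 scaler0 => /(tf _ _ I)[] /eqP.
    by rewrite (negbTE b0).
  by rewrite (negbTE x0).
have [c [d [e [z [_ [bE aE xE yE]]]]]] := ref _ _ _ _ b0 a0 I I x0 y0 bxay.
have cU : c \is a GRing.unit by apply: cab; [exists d | exists e].
by exists (c^-1 *: z); rewrite scalerA aE mulrAC divrr // mul1r xE.
Qed.

Lemma fraction_unique (A : idomainType) (M : lmodType A) (a : A) (m m' : M) :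
  PS_module M -> a != 0 -> a *: m = a *: m' -> m = m'.
Proof.
move=> [_ tf _] a0 /eqP; rewrite -subr_eq0 -scalerBr => /eqP /(tf _ _ I)[/eqP|].
  by rewrite (negbTE a0).
by move/eqP; rewrite subr_eq0 => /eqP.
Qed.

(* Main.v *)
Require Import Defs.
From HB Require Import structures.
From mathcomp Require Import all_boot all_order all_algebra.
From mathcomp Require Import boolp classical_sets.

(** Over a weak GCD domain, dividing an equality [a x = b y] by a maximal common
    divisor of [a] and [b] reduces its refinement to the coprime case, where the
    only candidate for the vector of the refinement is the fraction [x / b]. So a
    submodule of a PS module is PS if and only if it contains its own coprime
    fractions. This closure property passes to intersections, and to the union
    of the [N_n] because one fraction involves only two vectors, which lie in a
    common [N_n]. *)

Set Implicit Arguments.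
Unset Strict Implicit.
Unset Printing Implicit Defensive.

Import GRing.Theory.
Local Open Scope classical_set_scope.
Local Open Scope ring_scope.

Lemma submoduleP (A : idomainType) (M : lmodType A) (Q : set M) :
  submodule Q <->
  Q 0 /\ forall (a : A) (x y : M), Q x -> Q y -> Q (a *: x + y).
Proof.
split=> [[Q0 Qlin]|[Q0 Qlin]]; split.
- by move: Q0; rewrite !inE.
- by move=> a x y Qx Qy; have := Qlin a x y; rewrite !inE; apply.
- by rewrite !inE.
- by move=> a x y; rewrite !inE; apply: Qlin.
Qed.

Lemma submoduleZ (A : idomainType) (M : lmodType A) (Q : set M) (a : A) (x : M) :
  submodule Q -> Q x -> Q (a *: x).
Proof. by move=> /submoduleP[Q0 Qlin] Qx; rewrite -[_ *: _]addr0; apply: Qlin. Qed.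

Lemma submodule_bigcap (A : idomainType) (M : lmodType A) (F : set (set M)) :
  (forall Q, F Q -> submodule Q) -> submodule (\bigcap_(Q in F) Q).
Proof.
move=> Fsub; apply/submoduleP; split=> [Q /Fsub /submoduleP[]//|a x y Px Py Q FQ].
by have /submoduleP[_] := Fsub _ FQ; apply; [apply: Px | apply: Py].
Qed.

Lemma submodule_bigcup_chain (A : idomainType) (M : lmodType A)
    (F : nat -> set M) :
  (forall n, submodule (F n)) -> {homo F : m n / (m <= n)%N >-> m `<=` n} ->
  submodule (\bigcup_(n in [set: nat]) F n).
Proof.
move=> Fsub Fhomo; apply/submoduleP; split.
  by exists 0%N => //; case/submoduleP: (Fsub 0%N).
move=> a x y [i _ Fx] [j _ Fy]; exists (maxn i j) => //.
have /submoduleP[_] := Fsub (maxn i j); apply.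
  exact: Fhomo (leq_maxl i j) _ Fx.
exact: Fhomo (leq_maxr i j) _ Fy.
Qed.

Lemma generated_submodule_submodule (A : idomainType) (M : lmodType A)
    (S : set M) : submodule (generated_submodule S).
Proof. by apply: submodule_bigcap => Q []. Qed.

Lemma sub_generated_submodule (A : idomainType) (M : lmodType A) (S : set M) :
  S `<=` generated_submodule S.
Proof. by move=> x Sx Q [_]; apply. Qed.

Lemma generated_submodule_min (A : idomainType) (M : lmodType A) (S Q : set M) :
  submodule Q -> S `<=` Q -> generated_submodule S `<=` Q.
Proof. by move=> Qsub SQ x; apply. Qed.

Lemma coprime_elts_sym (A : idomainType) (a b : A) :
  coprime_elts a b -> coprime_elts b a.
Proof. by move=> cab d db da; apply: cab. Qed.

Lemma coprime_fractions_mono (A : idomainType) (M : lmodType A) (Q R : set M) :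
  Q `<=` R -> coprime_fractions Q `<=` coprime_fractions R.
Proof.
move=> QR m [a [b [x [hab [Qx [y Qy yE] mE]]]]].
by exists a, b, x; split=> //; split=> //; [apply: QR | exists y => //; apply: QR].
Qed.

(** Every [x] is the fraction [x / 1], with the coprime pair [1], [1]. *)
Lemma sub_coprime_fractions (A : idomainType) (M : lmodType A) (Q : set M) :
  Q `<=` coprime_fractions Q.
Proof.
move=> x Qx; exists 1, 1, x; split; split; rewrite ?oner_neq0 ?scale1r //.
  by move=> d [c /esym dc] _; apply/unitrPr; exists c.
by exists x; rewrite ?scale1r.
Qed.

Lemma coprime_fractions_bigcap (A : idomainType) (M : lmodType A)
    (F : set (set M)) :
  (forall Q, F Q -> coprime_fractions Q `<=` Q) ->
  coprime_fractions (\bigcap_(Q in F) Q) `<=` \bigcap_(Q in F) Q.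
Proof.
move=> Fcl m Pm Q FQ; apply: (Fcl _ FQ).
by apply: coprime_fractions_mono Pm => x; apply.
Qed.

Lemma sub_derived_submodule (A : idomainType) (M : lmodType A) (Q : set M) :
  Q `<=` derived_submodule Q.
Proof.
move=> x /(@sub_coprime_fractions A M Q); exact: sub_generated_submodule.
Qed.

(** Refining [b x = a y] inside [Q] gives [b = c e], [a = c d], [x = d z] with [z] in [Q].
    Coprimality makes the common divisor [c] a unit, so [x / a] is [z / c], again in [Q]. *)
Lemma PS_submodule_coprime_fractions (A : idomainType) (M : lmodType A)
    (Q : set M) :
  PS_module M -> PS_submodule Q -> coprime_fractions Q `<=` Q.
Proof.
move=> hM [Qsub tf ref] m [a [b [x [[a0 b0 cab] [Qx [y Qy yE] mE]]]]].
(* Refinements exist only for nonzero vectors, so the zero fraction is treated apart. *)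
have [x0|x0] := eqVneq x 0.
  have -> : m = 0 by apply: (fraction_unique hM a0); rewrite mE scaler0.
  by case/submoduleP: Qsub.
have y0 : y != 0.
  apply/eqP => y0; move: yE; rewrite y0 scaler0 => /esym /(tf _ _ Qx)[] /eqP.
    by rewrite (negbTE b0).
  by rewrite (negbTE x0).
have [c [d [e [z [Qz [bE aE xE _]]]]]] := ref _ _ _ _ b0 a0 Qx Qy x0 y0 (esym yE).
have cU : c \is a GRing.unit by apply: cab; [exists d | exists e].
suff -> : m = c^-1 *: z by apply: submoduleZ.
by apply: (fraction_unique hM a0); rewrite mE scalerA aE mulrAC divrr // mul1r.
Qed.

Lemma coprime_fractions_PS_submodule (A : idomainType) (M : lmodType A)
    (Q : set M) :
  weak_GCD_domain A -> PS_module M -> submodule Q ->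
  coprime_fractions Q `<=` Q -> PS_submodule Q.
Proof.
move=> hA hM Qsub Qcl; split=> //; first by case: hM => _ tf _ a x _; apply: tf.
move=> a b x y a0 b0 Qx Qy _ _ axby.
have [d [a' [b' [aE bE cab]]]] := hA _ _ a0 b0.
have [d0 a'0] : d != 0 /\ a' != 0.
  by apply/andP; rewrite -negb_or -mulf_eq0 -aE.
have b'0 : b' != 0 by move: b0; rewrite bE mulf_eq0 negb_or => /andP[].
have axby' : a' *: x = b' *: y.
  by apply: (fraction_unique hM d0); rewrite !scalerA -aE -bE.
have cba := coprime_elts_sym cab.
have [z zE] := fraction_exists hM b'0 a'0 cba axby'.
(* Here [z = x / b'], first found in [M]; it lies in [Q] as a coprime fraction, because
   [a' x = b' y] with [y] in [Q]. *)
exists d, b', a', z; split.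
  by apply: Qcl; exists b', a', x; split=> //; split=> //; exists y.
(* What remains is [y = a' z], checked after multiplication by [b']: [b' y = a' x = a' b' z]. *)
split=> //; apply: (fraction_unique hM b'0).
by rewrite -axby' -zE !scalerA mulrC.
Qed.

Theorem mainTheorem17 (A : idomainType) (M : lmodType A) (N : set M)
    (hA : weak_GCD_domain A) (hM : PS_module M) (hN : submodule N) :
  let P := \bigcap_(Q in [set Q : set M | PS_submodule Q /\ N `<=` Q]) Q in
  [/\ forall n : nat, submodule (derived_seq N n),
      forall n : nat, derived_seq N n `<=` derived_seq N n.+1,
      PS_submodule P
    & P = \bigcup_(n in [set: nat]) derived_seq N n].
Proof.
move=> P.
have Nsub n : submodule (derived_seq N n).
  by case: n => // n; apply: generated_submodule_submodule.
have Nincr n : derived_seq N n `<=` derived_seq N n.+1.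
  exact: sub_derived_submodule.
have Nhomo : {homo derived_seq N : m n / (m <= n)%N >-> m `<=` n}.
  by apply: homo_leq => [Q|Q R S|//]; [exact: subset_refl | exact: subset_trans].
split=> //.
  apply: coprime_fractions_PS_submodule => //.
    by apply: submodule_bigcap => Q [[]].
  apply: coprime_fractions_bigcap => Q [QPS _].
  exact: PS_submodule_coprime_fractions.
apply/seteqP; split.
  (* The union is itself one of the submodules intersected in [P], once it is shown to be PS. *)
  move=> m; apply; split; last by move=> x Nx; exists 0%N.
  apply: coprime_fractions_PS_submodule => //.
    exact: submodule_bigcup_chain.
  move=> {}m [a [b [x [hab [[i _ Ni] [y [j _ Nj] yE] mE]]]]].
  (* Both [x] and [y] lie in the term of index [maxn i j], so their fraction appears one index
     later. *)
  exists (maxn i j).+1 => //; apply: sub_generated_submodule.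
  exists a, b, x; split=> //; split=> //.
    exact: Nhomo (leq_maxl i j) _ Ni.
  by exists y => //; exact: Nhomo (leq_maxr i j) _ Nj.
(* Conversely, a PS submodule [Q] containing one term contains its coprime fractions, hence the next
   term. *)
move=> x [n _ Nx] Q [QPS NQ].
elim: n x Nx => [|n IHn]; first exact: NQ.
apply: generated_submodule_min; first by case: QPS.
apply: subset_trans (PS_submodule_coprime_fractions hM QPS).
exact: coprime_fractions_mono.
Qed.
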